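(* Let $d\geq 1$ be an integer. For every integer $f\geq d+1$ the 2-sumfree sequence $S_{f,f+d}$ is characterized as follows: a positive integer $z$ is an entry of $S_{f,f+d}$ if and only if either $z\in\{f,\,2f+d-1\}$, or $z>f+d-1$ and $z$ is congruent modulo $3f+d-1$ to one of the integers $f+d-1,\,f+d,\,\ldots,\,2f+d-2$. In particular, after the first $f+1$ entries (in a preperiod) the sequence $S_{f,f+d}$ modulo $3f+d-1$ is periodic with period length $f$.
   Context: For positive integers $f<g$, the (greedy, strict) 2-sumfree sequence $S_{f,g}=(s_1,s_2,s_3,\ldots)$ is defined by $s_1=f$, $s_2=g$, and, for $n>2$, $s_n$ is the smallest integer exceeding $s_{n-1}$ that is not equal to the sum of two different elements among $s_1,\ldots,s_{n-1}$. Saying that after the first $k$ entries $S$ modulo $m$ is periodic with period length $p$ means that $s_{n+p}=s_n+m$ for all $n>k$. *)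

(* Defs.v *)
From mathcomp Require Import all_boot.

Set Implicit Arguments.
Unset Strict Implicit.
Unset Printing Implicit Defensive.

Definition sum_of_two_different (l : seq nat) (z : nat) : bool :=
  has (fun x => has (fun y => (x != y) && (x + y == z)) l) l.

Lemma greedy_candidate (l : seq nat) :
  exists z, (last 0 l < z) && ~~ sum_of_two_different l z.
Proof.
exists (last 0 l + (sumn l).*2).+1; rewrite ltnS leq_addr /=.
have le_sumn x : x \in l -> x <= sumn l.
  elim: l => //= y l IHl; rewrite inE => /orP[/eqP -> | /IHl le_x].
    exact: leq_addr.
  exact: leq_trans le_x (leq_addl _ _).
apply/hasP => -[x /le_sumn lex] /hasP[y /le_sumn ley] /andP[_ /eqP xy].
have := leq_add lex ley; rewrite xy addnn => /leq_trans/(_ (leq_addl (last 0 l) _)).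
by rewrite ltnn.
Qed.

Definition greedy_next (l : seq nat) : nat := ex_minn (greedy_candidate l).

(* The list [:: s_1; ...; s_n] of the first n entries of S_{f,g}. *)
Fixpoint sumfree_prefix (f g n : nat) : seq nat :=
  match n with
  | 0 => [::]
  | 1 => [:: f]
  | 2 => [:: f; g]
  | n'.+1 => let l := sumfree_prefix f g n' in rcons l (greedy_next l)
  end.

(* The entry s_n of S_{f,g}, indexed from n = 1; the value at n = 0 is junk. *)
Definition sumfree_seq (f g n : nat) : nat := last 0 (sumfree_prefix f g n).

Definition sumfree_entry (f g z : nat) : Prop :=
  exists n, 0 < n /\ sumfree_seq f g n = z.

(* After its first k entries, the sequence s (indexed from 1) modulo m is
   periodic with period length p: the entries themselves shift by m, and
   p is not required to be minimal. *)
Definition periodic_mod_after (s : nat -> nat) (k m p : nat) : Prop :=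
  forall n, k < n -> s (n + p) = s n + m.

(* Main.v *)
Require Import Defs.
From mathcomp Require Import all_boot.
From mathcomp Require Import zify.

(** The greedy sequence is determined by a fixed-point property: if an
    increasing sequence starts with [f], [g], and a number beyond [g] is one of
    its values exactly when it is not a sum of two different values, then it is
    the greedy sequence ([sumfree_seq_enum]).  The reason is that, the values
    being positive, the two summands of a sum are smaller than the sum, so that
    only earlier values matter.

    It remains to verify this property for the claimed set.  Put [e = d - 1],
    which also removes all the truncated subtractions, and [M = 3f + e].  The
    claimed set consists of [f], of [2f + e], and of the numbers beyond [f + e]
    in the blocks [kM + [f + e, 2f + e)].  Each block is followed by the gap
    [kM + [2f + e, 4f + 2e)], and [2f + e] is the first number of the first gap.

    The sum of two different claimed entries lies in a gap, hence in no block
    ([claimed_sum_in_gap]).  Up to multiples of [M], adding two block members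
    gives [2f + 2e .. 4f + 2e - 2], adding [f] to a block member gives
    [2f + e .. 3f + e - 1], adding [2f + e] to it gives
    [3f + 2e .. 4f + 2e - 1], and [f + (2f + e)] is [M]; all of these are in the
    range [2f + e .. 4f + 2e - 1] of a gap.  The exceptional entry [2f + e] is
    not a sum either, being smaller than [f + (f + e + 1)].

    Conversely, every number of a gap other than [2f + e] is such a sum
    ([gap_is_sum]).  In the [k]-th gap with [k > 0], it is the sum of a member of
    the [k]-th block with, from the left to the right of the gap, [f], the entry
    [f + e + 1], or [2f + e].  The gap after the first block is covered in the
    same way, except that the summands have to be chosen different.  The
    hypothesis [f >= d + 1] is what makes the three ranges cover the gap. *)

(** * Recognizing a greedy sum-free sequence *)

Lemma greedy_next_eq (l : seq nat) (z : nat) :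
  last 0 l < z -> ~~ sum_of_two_different l z ->
  (forall y, last 0 l < y < z -> sum_of_two_different l y) ->
  greedy_next l = z.
Proof.
move=> lt_z nsum_z sum_lt; rewrite /greedy_next.
case: ex_minnP => m /andP[lt_m nsum_m] /(_ z); rewrite lt_z nsum_z => /(_ isT).
rewrite leq_eqVlt => /orP[/eqP // | lt_mz].
by move: nsum_m; rewrite sum_lt // lt_m.
Qed.

Lemma sum_of_two_different_mkseqP (u : nat -> nat) (n z : nat) :
  injective u ->
  reflect (exists i j, [/\ i < n, j < n, i <> j & u i + u j = z])
          (sum_of_two_different (mkseq u n) z).
Proof.
move=> u_inj; apply: (iffP hasP) => [[x /mapP[i]] | [i [j [ltin ltjn neq_ij Dz]]]].
  rewrite mem_iota => ltin -> /hasP[y /mapP[j]].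
  rewrite mem_iota => ltjn -> /andP[/eqP neq_u /eqP Dz].
  by exists i, j; split=> // eq_ij; apply: neq_u; rewrite eq_ij.
exists (u i); first by rewrite map_f // mem_iota.
apply/hasP; exists (u j); first by rewrite map_f // mem_iota.
by rewrite Dz eqxx andbT; apply/eqP => /u_inj.
Qed.

(** The hypothesis on [z] quantifies over all values of [u], whereas the greedy
    rule only sees the values already chosen; positivity bridges the two. *)
Lemma sumfree_prefix_enum (f g : nat) (u : nat -> nat) :
  0 < f -> u 0 = f -> u 1 = g -> (forall n, u n < u n.+1) ->
  (forall z, g < z -> (exists n, u n = z) <->
                      ~ (exists i j, i <> j /\ u i + u j = z)) ->
  forall n, sumfree_prefix f g n = mkseq u n.
Proof.
move=> f_gt0 u0 u1 u_incr u_greedy.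
have u_mono : {mono u : i j / i <= j}.
  exact: leq_mono (homo_ltn (@ltn_trans) u_incr).
have u_ltn : {mono u : i j / i < j} := leqW_mono u_mono.
have u_inj : injective u.
  by move=> i j eq_u; apply/eqP; rewrite eqn_leq -(u_mono i) -(u_mono j) eq_u leqnn.
have u_gt0 i : 0 < u i by rewrite (leq_trans f_gt0) // -u0 u_mono.
elim=> [|[|[|n]] IHn] //; first by rewrite /mkseq /= u0.
  by rewrite /mkseq /= u0 u1.
rewrite -[LHS]/(rcons (sumfree_prefix f g n.+2)
                      (greedy_next (sumfree_prefix f g n.+2))).
rewrite IHn [RHS]mkseqS; congr rcons.
have last_u : last 0 (mkseq u n.+2) = u n.+1 by rewrite mkseqS last_rcons.
have g_le : g <= u n.+1 by rewrite -u1 u_mono.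
apply: greedy_next_eq => [||y]; first by rewrite last_u.
  apply/(sum_of_two_different_mkseqP u _ _ u_inj) => -[i [j [_ _ neq_ij Dz]]].
  have /u_greedy[not_sum _] := leq_ltn_trans g_le (u_incr n.+1).
  by apply: not_sum; [exists n.+2 | exists i, j].
rewrite last_u => /andP[lt_y y_lt].
have /u_greedy in_or_sum := leq_ltn_trans g_le lt_y.
apply: contraT => /(sum_of_two_different_mkseqP u _ _ u_inj) not_sum.
have [m Dy] : exists m, u m = y.
  apply/in_or_sum => -[i [j [neq_ij Dy]]]; apply: not_sum; exists i, j.
  have := u_gt0 i; have := u_gt0 j => uj_gt0 ui_gt0.
  by split=> //; rewrite -u_ltn (leq_ltn_trans _ y_lt) // -Dy ?leq_addr ?leq_addl.
by move: lt_y y_lt; rewrite -Dy !u_ltn; lia.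
Qed.

Lemma sumfree_seq_enum (f g : nat) (u : nat -> nat) :
  0 < f -> u 0 = f -> u 1 = g -> (forall n, u n < u n.+1) ->
  (forall z, g < z -> (exists n, u n = z) <->
                      ~ (exists i j, i <> j /\ u i + u j = z)) ->
  forall n, sumfree_seq f g n.+1 = u n.
Proof.
move=> f_gt0 u0 u1 u_incr u_greedy n.
by rewrite /sumfree_seq (sumfree_prefix_enum f g u) // mkseqS last_rcons.
Qed.

(** * Blocks and gaps *)

Definition in_block (f e z : nat) : Prop :=
  exists k r, z = k * (3 * f + e) + r /\ f + e <= r < 2 * f + e.

Definition in_gap (f e z : nat) : Prop :=
  exists k s, z = k * (3 * f + e) + s /\ 2 * f + e <= s < 4 * f + 2 * e.

Definition claimed (f e z : nat) : Prop :=
  (z = f \/ z = 2 * f + e) \/ (f + e < z /\ in_block f e z).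

Lemma block_or_gap (f e z : nat) :
  0 < f -> f + e <= z -> in_block f e z \/ in_gap f e z.
Proof.
move=> f_gt0 le_z; pose y := z - (f + e).
have M_gt0 : 0 < 3 * f + e by lia.
have Dz := divn_eq y (3 * f + e); have := ltn_pmod y M_gt0.
move: (y %/ _) (y %% _) Dz => k r Dz ltrM.
have {}Dz : z = k * (3 * f + e) + (f + e + r) by lia.
have [ltrf | lefr] := ltnP r f; [left | right]; exists k, (f + e + r); lia.
Qed.

Lemma block_gap_disjoint (f e z : nat) : in_block f e z -> ~ in_gap f e z.
Proof.
move=> [k [r [-> r_bd]]] [l [s [eq_z s_bd]]].
have [le_kl | lt_lk] := leqP k l.
  by have := leq_mul le_kl (leqnn (3 * f + e)); lia.
by have := leq_mul lt_lk (leqnn (3 * f + e)); lia.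
Qed.

Lemma claimed_sum_in_gap (f e x y : nat) :
  0 < f -> claimed f e x -> claimed f e y -> x <> y -> in_gap f e (x + y).
Proof.
move=> f_gt0 Tx Ty.
wlog: x y Tx Ty / (x = f \/ x = 2 * f + e) \/
  ((f + e < x /\ in_block f e x) /\ f + e < y /\ in_block f e y).
  move=> IH neq_xy; case: (Tx) (Ty) => [?|Bx] [?|By]; try by apply: IH; tauto.
  by rewrite addnC; apply: IH; [| |tauto|]; auto.
case=> [Dx neq_xy | [[_ [k [r [-> r_bd]]]] [_ [l [s [-> s_bd]]]]] _]; last first.
  by exists (k + l), (r + s); lia.
case: Ty => [Dy | [_ [l [s [Dy s_bd]]]]]; first by exists 0, (x + y); lia.
by exists l, (x + s); lia.
Qed.

(** In the gap after the [0]-th block, [f + e] is not available as a summand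
    while [2f + e] is, so that the usable numbers form the run
    [f + e + 1 .. 2f + e].  Its sums with [f] reach [3f + e], its sums with its
    own smallest member start at [2f + 2e + 3] and reach [3f + 2e + 1], and its
    sums with its largest member reach [4f + 2e - 1], the end of the gap. *)
Lemma gap_is_sum (f e z : nat) :
  e + 2 <= f -> 2 * f + e < z -> in_gap f e z ->
  exists x y, [/\ claimed f e x, claimed f e y, x <> y & x + y = z].
Proof.
move=> hf lt_z [k [s [Dz s_bd]]].
have claimed_f : claimed f e f by left; left.
have claimed_B : claimed f e (2 * f + e) by left; right.
have claimed_blk l r : f + e <= r < 2 * f + e -> f + e < l * (3 * f + e) + r ->
    claimed f e (l * (3 * f + e) + r).
  by move=> r_bd lt_r; right; split=> //; exists l, r.
have claimed_run x : f + e < x <= 2 * f + e -> claimed f e x.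
  move=> x_bd; have [->//|neq_x] := eqVneq x (2 * f + e).
  by apply: (claimed_blk 0); lia.
case: k Dz => [|k] Dz.
  have [le_s | lt_s] := leqP s (3 * f + e).
    by exists f, (s - f); split=> //; [apply: claimed_run|..]; lia.
  have [le_s' | lt_s'] := leqP s (3 * f + 2 * e + 1).
    by exists (f + e + 1), (s - (f + e + 1)); split; try apply: claimed_run; lia.
  by exists (2 * f + e), (s - (2 * f + e)); split; try apply: claimed_run; lia.
have le_M : 3 * f + e <= k.+1 * (3 * f + e) by rewrite leq_pmull.
move: (k.+1) Dz le_M => {}k Dz le_M.
have [le_s | lt_s] := ltnP s (3 * f + e).
  by exists f, (k * (3 * f + e) + (s - f)); split=> //; try apply: claimed_blk; lia.
have [le_s' | lt_s'] := ltnP s (3 * f + 2 * e).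
  exists (f + e + 1), (k * (3 * f + e) + (s - (f + e + 1))).
  by split; [apply: claimed_run|apply: claimed_blk|..]; lia.
exists (2 * f + e), (k * (3 * f + e) + (s - (2 * f + e))).
by split=> //; try apply: claimed_blk; lia.
Qed.

(** * The increasing enumeration of the claimed entries *)

(** After [f], the entries come in runs of length [f], the [k]-th one filling
    the [k]-th block.  The exception is the run [k = 0], which is shifted by one
    since it leaves out [f + e] and ends with [2f + e]. *)
Definition entry (f e n : nat) : nat :=
  if n is m.+1 then m %/ f * (3 * f + e) + (f + e) + m %% f + (m < f) else f.

Lemma entry_block (f e k j : nat) :
  j < f -> entry f e (k * f + j).+1 =
           k * (3 * f + e) + (f + e) + j + (k == 0).
Proof.
move=> lt_jf; have f_gt0 : 0 < f by lia.
rewrite /entry divnMDl // divn_small // addn0 modnMDl modn_small //.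
by case: k => [|k]; rewrite ?mul0n ?lt_jf // mulSn; lia.
Qed.

Lemma entry_incr (f e n : nat) : 0 < f -> entry f e n < entry f e n.+1.
Proof.
move=> f_gt0; case: n => [|m].
  by have /= := entry_block f e 0 0 f_gt0; rewrite mul0n !add0n => ->; lia.
have lt_jf := ltn_pmod m f_gt0.
rewrite (divn_eq m f); move: (m %/ f) (m %% f) lt_jf => k j lt_jf.
rewrite entry_block // -[(k * f + j).+1]addnS.
have [lt_jf' | le_fj] := ltnP j.+1 f; first by rewrite entry_block //; lia.
have -> : k * f + j.+1 = k.+1 * f + 0 by lia.
by rewrite entry_block // mulSn; lia.
Qed.

Lemma entry_periodic (f e n : nat) :
  0 < f -> f < n -> entry f e (n + f) = entry f e n + (3 * f + e).
Proof.
move=> f_gt0; case: n => // m; rewrite ltnS => le_fm.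
rewrite addSn /entry divnDr // divnn f_gt0 modnDr mulnDl mul1n.
have -> : m < f = false by lia.
have -> : m + f < f = false by lia.
by lia.
Qed.

Lemma entryP (f e z : nat) :
  0 < f -> (exists n, entry f e n = z) <-> claimed f e z.
Proof.
move=> f_gt0; split=> [[[<- | m <-]] | [[-> | ->] | [lt_z [k [r [Dz r_bd]]]]]].
- by left; left.
- have lt_jf := ltn_pmod m f_gt0; rewrite (divn_eq m f).
  move: (m %/ f) (m %% f) lt_jf => k j lt_jf; rewrite entry_block //.
  case: k => [|k].
    have [eq_j | neq_j] := eqVneq j.+1 f; first by left; right; lia.
    by right; split; last exists 0, (f + e + j + 1); lia.
  by right; split; last exists k.+1, (f + e + j); rewrite ?mulSn; lia.
- by exists 0.
- exists (0 * f + f.-1).+1; rewrite entry_block; lia.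
have [Dk | k_neq0] := eqVneq k 0.
  by exists (0 * f + (r - (f + e + 1))).+1; rewrite entry_block; lia.
by exists (k * f + (r - (f + e))).+1; rewrite entry_block; lia.
Qed.

Lemma sumfree_seq_entry (f e n : nat) :
  e + 2 <= f -> sumfree_seq f (f + e.+1) n.+1 = entry f e n.
Proof.
move=> hf; have f_gt0 : 0 < f by lia.
apply: sumfree_seq_enum => // [|m|z lt_z].
- by have := entry_block f e 0 0 f_gt0; rewrite mul0n add0n => ->; lia.
- exact: entry_incr.
have incr_inj i j : i <> j -> entry f e i <> entry f e j.
  wlog lt_ij : i j / i < j => [IH neq_ij | _ eq_ij].
    have [/IH|lt_ji|//] := ltngtP i j; first exact.
    by apply/nesym/IH => //; apply/nesym.
  have := homo_ltn ltn_trans (fun m => entry_incr f e m f_gt0) lt_ij.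
  by rewrite eq_ij ltnn.
split=> [/(entryP f e _ f_gt0) Tz [i [j [neq_ij Dz]]] | not_sum].
  have Ti : claimed f e (entry f e i) by apply/entryP => //; exists i.
  have Tj : claimed f e (entry f e j) by apply/entryP => //; exists j.
  have gap_z : in_gap f e z.
    by rewrite -Dz; apply: claimed_sum_in_gap => //; apply: incr_inj.
  case: Tz => [[|Dz'] | [_ /block_gap_disjoint/(_ gap_z)//]]; first by lia.
  (* Two different entries add up to at least f + (f + e + 1), hence not to 2f + e. *)
  have ge_f : forall x, claimed f e x -> x = f \/ f + e < x.
    by move=> x [[]|[]]; lia.
  by have := incr_inj i j neq_ij; have := ge_f _ Ti; have := ge_f _ Tj; lia.
apply/entryP => //.
have [Bz | Gz] := block_or_gap f e z f_gt0 ltac:(lia).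
  by right; split=> //; lia.
have ge_z : 2 * f + e <= z by case: Gz => k [s [-> ?]]; lia.
have [-> | neq_z] := eqVneq z (2 * f + e); first by left; right.
have [|x [y [Tx Ty neq_xy Dz]]] := gap_is_sum f e z hf _ Gz; first by lia.
have [i Di] := (entryP f e x f_gt0).2 Tx; have [j Dj] := (entryP f e y f_gt0).2 Ty.
case: not_sum; exists i, j; rewrite Di Dj; split=> // eq_ij.
by apply: neq_xy; rewrite -Di -Dj eq_ij.
Qed.

Lemma in_block_modP (f e z : nat) :
  in_block f e z <->
  exists r, f + e <= r < 2 * f + e /\ z = r %[mod 3 * f + e].
Proof.
split=> [[k [r [-> r_bd]]] | [r [r_bd eq_zr]]].
  by exists r; rewrite modnMDl.
exists (z %/ (3 * f + e)), r; split=> //.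
by rewrite {1}(divn_eq z (3 * f + e)) eq_zr (@modn_small r) //; lia.
Qed.

Theorem theorem13 (d : nat) (hd : 1 <= d) (f : nat) (hf : d + 1 <= f) :
  (forall z : nat, 0 < z ->
     (sumfree_entry f (f + d) z <->
        (z = f \/ z = 2 * f + d - 1) \/
        (f + d - 1 < z /\
         exists r : nat, f + d - 1 <= r <= 2 * f + d - 2 /\
                         z = r %[mod 3 * f + d - 1])))
  /\ periodic_mod_after (sumfree_seq f (f + d)) (f + 1) (3 * f + d - 1) f.
Proof.
case: d hd hf => // e _ hf; have f_gt0 : 0 < f by lia.
have {}hf : e + 2 <= f by lia.
have -> : 3 * f + e.+1 - 1 = 3 * f + e by lia.
have -> : 2 * f + e.+1 - 1 = 2 * f + e by lia.
have -> : f + e.+1 - 1 = f + e by lia.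
split=> [z _ | [|n] lt_n]; last 2 first.
- by lia.
- by rewrite addSn !sumfree_seq_entry // entry_periodic //; lia.
have entry_claimed : sumfree_entry f (f + e.+1) z <-> claimed f e z.
  rewrite -(entryP f e z f_gt0); split=> [[[|n] [//= _]] | [n]].
    by rewrite sumfree_seq_entry // => <-; exists n.
  by move=> <-; exists n.+1; rewrite sumfree_seq_entry.
rewrite entry_claimed /claimed in_block_modP.
split=> -[|[lt_z [r [r_bd eq_zr]]]]; try by left.
  by right; split=> //; exists r; split=> //; lia.
by right; split=> //; exists r; split=> //; lia.
Qed.
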